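(* Let $k\ge1$, $n\ge2$, $m=kn+1$, $n'=n-1$, $m'=kn'+1$, and let $T'\in\mathcal T^k_{n'}$. Then the number of $D\in\mathcal D_{m,n}$ with $\mathrm{red}(T(D))=T'$ equals $T'_{k+1,1}$, the last entry of the first column of $T'$. Moreover, all such $D$ are obtained as follows: let $D'\in\mathcal D_{m',n'}$ be the path with $T(D')=T'$ and $P'=\Phi^{-1}(D')$; for each vertex $v$ of $P'$ other than its endpoint whose rank (computed with respect to $(m',n')$) is less than $m'$, write $P'=AB$ where $A$ is the part of $P'$ before $v$ and $B$ the part after $v$; form the path $P=N\,B\,A\,E^k$ (a North step, then $B$, then $A$, then $k$ East steps); then $P\in\mathcal D_{m,n}$ and the desired paths are exactly the $D=\Phi(P)$ so obtained.
   Context: For coprime $m,n$, $\mathcal D_{m,n}$ is the set of lattice paths from $(0,0)$ to $(m,n)$ with unit North and East steps staying weakly above the segment from $(0,0)$ to $(m,n)$. The rank of a lattice point $(x,y)$ is $ym-xn$. $\mathrm{SW}(P)$ is the step word ($S$ for North, $W$ for East). The sweep map $\Phi:\mathcal D_{m,n}\to\mathcal D_{m,n}$ sends $P$ to the path whose $i$-th step is North iff the step of $P$ with the $i$-th smallest starting rank is North; it is a bijection when $m=kn+1$. For $m=kn+1$, $T(D)$ is the array with $k+1$ rows and $n$ columns produced by the filling algorithm: place $1$ at the top of column 1; for $i=2,\dots,m+n-1$, if the $i$-th letter of $\mathrm{SW}(D)$ is $S$ place $i$ at the top of the leftmost empty column, and if $W$ place $i$ immediately below the smallest active entry (lowest in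 its column and not in row $k+1$). $\mathcal T^k_n$ is the set of arrays with $k+1$ rows and $n$ columns containing $1,\dots,(k+1)n$, increasing along rows and down columns, such that whenever $a<b<c<d$ with $d$ immediately below $a$, $b$ and $c$ are not in the same column; $D\mapsto T(D)$ is a bijection $\mathcal D_{kn+1,n}\to\mathcal T^k_n$. $\mathrm{red}(T)$ is obtained from $T$ by deleting its first column and replacing the remaining entries by $1,\dots,(k+1)(n-1)$ order-preservingly. $T_{i,j}$ is the entry in row $i$, column $j$. *)

(* Defs.v *)
From mathcomp Require Import all_boot all_order all_algebra.

Set Implicit Arguments.
Unset Strict Implicit.
Unset Printing Implicit Defensive.

(* A lattice path starting at (0,0) is its step word: [true] is a North step
   (letter S) and [false] is an East step (letter W). *)
Notation North := true (only parsing).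
Notation East := false (only parsing).
Definition lpath := seq bool.

(* Vertex number [i] of a path, counted from 0, is (xcoord w i, ycoord w i);
   it is the starting point of the step [nth East w i]. *)
Definition xcoord (w : lpath) (i : nat) : nat := count_mem East (take i w).
Definition ycoord (w : lpath) (i : nat) : nat := count_mem North (take i w).

Definition rank (m n x y : nat) : int := ((y * m)%:Z - (x * n)%:Z)%R.
Definition vrank (m n : nat) (w : lpath) (i : nat) : int :=
  rank m n (xcoord w i) (ycoord w i).

(* The segment from (0,0) to (m,n) is n * x = m * y; a path with unit steps is
   weakly above it iff all its vertices are. *)
Definition dyck (m n : nat) (w : lpath) : bool :=
  [&& count_mem East w == m, count_mem North w == n &
      all (fun i => xcoord w i * n <= ycoord w i * m) (iota 0 (size w).+1)].

(* When m and n are coprime the starting ranks of the steps of a path to (m,n)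
   are pairwise distinct, so the sorting order is unambiguous. *)
Definition sweep (m n : nat) (w : lpath) : lpath :=
  [seq nth East w i
     | i <- sort (fun i j => (vrank m n w i <= vrank m n w j)%R)
                 (iota 0 (size w))].

(* Filling algorithm. The state is the list of the columns, each read from top
   to bottom. On a path of [dyck (k * n + 1) n] an empty column (for S) or an
   active entry (for W) is always available, so the out-of-range indices
   returned by [leftmost_empty] and [smallest_active] otherwise play no role. *)
Definition put (cols : seq (seq nat)) (j i : nat) : seq (seq nat) :=
  set_nth [::] cols j (rcons (nth [::] cols j) i).

Definition leftmost_empty (cols : seq (seq nat)) : nat := index [::] cols.

Definition active (k : nat) (cols : seq (seq nat)) (j : nat) : bool :=
  0 < size (nth [::] cols j) < k.+1.

Definition lowest (cols : seq (seq nat)) (j : nat) : nat :=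
  last 0 (nth [::] cols j).

Definition smallest_active (k : nat) (cols : seq (seq nat)) : nat :=
  head (size cols)
    (sort (fun j1 j2 => lowest cols j1 <= lowest cols j2)
          [seq j <- iota 0 (size cols) | active k cols j]).

Definition fill_step (k : nat) (D : lpath) (cols : seq (seq nat)) (i : nat) :
    seq (seq nat) :=
  put cols
    (if nth East D i.-1 == North then leftmost_empty cols
     else smallest_active k cols) i.

Definition fill (k n : nat) (D : lpath) : seq (seq nat) :=
  let m := k * n + 1 in
  foldl (fill_step k D) (put (nseq n [::]) 0 1) (iota 2 (m + n - 2)).

Definition tableau (k n : nat) (D : lpath) : 'M[nat]_(k.+1, n) :=
  \matrix_(i < k.+1, j < n) nth 0 (nth [::] (fill k n D) j) i.

Definition fuss_tableau (k n : nat) (T : 'M[nat]_(k.+1, n)) : Prop :=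
  [/\ perm_eq [seq T ij.1 ij.2 | ij : 'I_k.+1 * 'I_n] (iota 1 (k.+1 * n)),
      forall (i : 'I_k.+1) (j1 j2 : 'I_n), j1 < j2 -> T i j1 < T i j2,
      forall (i1 i2 : 'I_k.+1) (j : 'I_n), i1 < i2 -> T i1 j < T i2 j &
      forall (i1 i2 : 'I_k.+1) (j : 'I_n), i2 = i1.+1 :> nat ->
      forall (r s : 'I_k.+1) (l : 'I_n),
        ~ [/\ T i1 j < T r l, T r l < T s l & T s l < T i2 j]].

(* For pairwise distinct entries, replacing each entry by the number of entries
   not exceeding it is the order-preserving relabelling by 1, 2, 3, ... *)
Definition standardize (p q : nat) (A : 'M[nat]_(p, q)) : 'M[nat]_(p, q) :=
  \matrix_(i < p, j < q) #|[set ab : 'I_p * 'I_q | A ab.1 ab.2 <= A i j]|.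

Definition red (k n : nat) (T : 'M[nat]_(k.+1, n.+1)) : 'M[nat]_(k.+1, n) :=
  standardize (col' ord0 T).

Definition cut_path (k : nat) (P' : lpath) (v : nat) : lpath :=
  let A := take v P' in
  let B := drop v P' in
  [:: North] ++ B ++ A ++ nseq k East.

(* Main.v *)
Require Import Defs.
From mathcomp Require Import all_boot all_order all_algebra zify.

(* Let s_1 < ... < s_n be the starting ranks of the North steps of a path P.
   Everything rests on the identity: T(Phi(P)) is the standardization of the
   array with entries s_j + i n, 0 <= i <= k. Indeed East steps lower the rank
   by n and North steps raise it by k n + 1, so a telescoping count along P
   shows that, for each entry y of this array, exactly as many entries as
   ranks are <= y; and the order of the array is the first-in first-out order
   of the filling algorithm. The end positions of the steps of P can be read
   off the tableau, so Phi is injective, hence bijective by finiteness.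
   Cutting P' at v maps the North starting ranks (other than the new 0) by a
   strictly increasing function sending z + n' to its value at z plus n. Hence
   the reduced tableau is unchanged. Conversely every P is N Q E^k, and rotating
   Q at a vertex of minimal rank recovers P'. The vertices of rank < m' are
   those of rank <= s_1 + k n' = k n', counted by the entry T'_{k+1,1}. *)

Set Implicit Arguments.
Unset Strict Implicit.
Unset Printing Implicit Defensive.

(** * Ranks along a Dyck path *)

Lemma xcoordS (w : lpath) t :
  t < size w -> xcoord w t.+1 = xcoord w t + ~~ nth East w t.
Proof.
move=> lt_t; rewrite /xcoord (take_nth East lt_t) -cats1 count_cat /= addn0.
by case: (nth _ _ _).
Qed.

Lemma ycoordS (w : lpath) t :
  t < size w -> ycoord w t.+1 = ycoord w t + nth East w t.
Proof.
move=> lt_t; rewrite /ycoord (take_nth East lt_t) -cats1 count_cat /= addn0.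
by case: (nth _ _ _).
Qed.

Lemma count_steps (w : lpath) : count_mem East w + count_mem North w = size w.
Proof.
rewrite -(count_predC (pred1 East) w); congr addn.
by apply: eq_count => -[].
Qed.

Lemma coord_sum (w : lpath) t : t <= size w -> xcoord w t + ycoord w t = t.
Proof. by move=> le_t; rewrite /xcoord /ycoord count_steps size_takel. Qed.

Lemma coord_mono (w : lpath) t u : t <= u ->
  xcoord w t <= xcoord w u /\ ycoord w t <= ycoord w u.
Proof.
move=> le_tu; rewrite /xcoord /ycoord -(subnKC le_tu) takeD !count_cat.
by rewrite !leq_addr.
Qed.

Lemma dyckP m n (w : lpath) : reflect
  [/\ count_mem East w = m, count_mem North w = n, size w = m + n &
      forall t, t <= size w -> xcoord w t * n <= ycoord w t * m] (dyck m n w).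
Proof.
apply: (iffP and3P) => [[/eqP ex /eqP ey /allP H]|[ex ey _ H]].
  split=> //; first by rewrite -count_steps ex ey.
  by move=> t le_t; apply: H; rewrite mem_iota.
split; [exact/eqP|exact/eqP|apply/allP => t].
by rewrite mem_iota => /andP[_ lt_t]; apply: H.
Qed.

(** On the vertices of a Dyck path the truncated subtraction is exact, so this is [vrank] with
    values in [nat], where residues modulo [n] are available. *)
Definition nrank (m n : nat) (w : lpath) (t : nat) : nat :=
  ycoord w t * m - xcoord w t * n.

Lemma vrank_nrank m n (w : lpath) t : dyck m n w -> t <= size w ->
  vrank m n w t = (nrank m n w t)%:Z%R.
Proof.
by move=> /dyckP[_ _ _ H] /H le_t; rewrite /vrank /rank /nrank; lia.
Qed.

Section DyckRanks.
Variables (k n : nat) (w : lpath).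
Local Notation m := (k * n + 1).
Hypotheses (n_gt0 : 0 < n) (w_dyck : dyck m n w).
Local Notation r := (nrank m n w).

Lemma size_dyck : size w = k.+1 * n + 1.
Proof. by case/dyckP: w_dyck => _ _ -> _; rewrite mulSn addnAC [n + _]addnC. Qed.

Lemma dyck_le t : t <= size w -> xcoord w t * n <= ycoord w t * m.
Proof. by case/dyckP: w_dyck => _ _ _; apply. Qed.

Lemma coord_bound t : xcoord w t <= m /\ ycoord w t <= n.
Proof.
case/dyckP: w_dyck => <- <- _ _; rewrite /xcoord /ycoord.
by split; rewrite -[X in _ <= count _ X](cat_take_drop t w) count_cat leq_addr.
Qed.

Lemma nrank0 : r 0 = 0. Proof. by rewrite /nrank /ycoord take0. Qed.

Lemma nrank_size : r (size w) = 0.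
Proof.
case/dyckP: w_dyck => ex ey _ _; rewrite /nrank /xcoord /ycoord take_size.
by rewrite ex ey mulnC subnn.
Qed.

Lemma nrank_north t : t < size w -> nth East w t -> r t.+1 = r t + k * n + 1.
Proof.
move=> lt_t wt; have := dyck_le (ltnW lt_t).
rewrite /nrank xcoordS // ycoordS // wt /= mulnDl mul1n addn0; lia.
Qed.

Lemma nrank_east t : t < size w -> ~~ nth East w t -> r t = r t.+1 + n.
Proof.
move=> lt_t wt; have := dyck_le (ltnW lt_t); have := dyck_le lt_t.
rewrite /nrank xcoordS // ycoordS // wt (negbTE wt) /= mulnDl mul1n addn0; lia.
Qed.

(** The modulus works because [m = k * n + 1] is [1] modulo [n]. *)
Lemma nrank_modn t : t <= size w -> r t = ycoord w t %[mod n].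
Proof.
move=> le_t; rewrite -(modnMDl (xcoord w t) (r t)) /nrank.
rewrite subnKC ?dyck_le // mulnDr muln1 mulnA.
by rewrite modnMDl.
Qed.

Lemma nrank_inj t u : t < size w -> u < size w -> r t = r u -> t = u.
Proof.
wlog lt_tu : t u / t < u => [IH lt_t lt_u e|lt_t lt_u e].
  case: (ltngtP t u) => // [lt_tu|lt_ut]; first exact: IH.
  by apply/esym; apply: IH.
have [] := coord_mono w (ltnW lt_tu).
have := coord_sum (ltnW lt_t); have := coord_sum (ltnW lt_u).
have := dyck_le (ltnW lt_t); have := dyck_le (ltnW lt_u).
have [] := coord_bound u; have sz := size_dyck; move: e.
rewrite /nrank; set x := xcoord w t; set y := ycoord w t.
set x' := xcoord w u; set y' := ycoord w u => e bx by_ le_u le_t su st le_x le_y.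
have {}e : (y' - y) * (k * n + 1) = (x' - x) * n.
  have := leq_mul le_x (leqnn n); have := leq_mul le_y (leqnn (k * n + 1)).
  by rewrite !mulnBl; lia.
have dv : n %| (y' - y) * (k * n + 1) by rewrite e dvdn_mull.
have {}dv : n %| y' - y.
  by rewrite mulnDr muln1 dvdn_addr // mulnA dvdn_mull in dv.
case/dvdnP: dv => q eq_q.
(* The height difference is [0] or [n]: in the first case the vertices coincide, in the second [u]
   is the endpoint of the path, which starts no step. *)
case: q eq_q => [|[|q]] eq_q; last by move: eq_q; nia.
- have ex : x' - x = 0.
    by apply/eqP; rewrite -(eqn_pmul2r n_gt0) -e eq_q.
  lia.
- have ex : x' - x = k * n + 1.
    by apply/eqP; rewrite -(eqn_pmul2r n_gt0) -e eq_q mul1n mulnC.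
  lia.
Qed.

(** North steps start at distinct heights below [n], and the height is the rank modulo [n]. *)
Lemma north_same_residue t u : t < size w -> u < size w ->
  nth East w t -> nth East w u -> r t = r u %[mod n] -> t = u.
Proof.
move=> lt_t lt_u wt wu; rewrite !nrank_modn 1?ltnW //.
have [_] := coord_bound t.+1; have [_] := coord_bound u.+1.
rewrite !ycoordS // wt wu !addn1 => bu bt; rewrite !modn_small // => e.
case: (ltngtP t u) => // lt_tu; have [_] := coord_mono w lt_tu;
  rewrite ycoordS // ?wt ?wu; lia.
Qed.

Lemma nth_head_dyck : nth East w 0.
Proof.
apply/negPn/negP => w0; have sz := size_dyck.
have lt0 : 0 < size w by lia.
by have := nrank_east lt0 w0; rewrite nrank0; lia.
Qed.

(* The potential [c] counts the points of [r + n, r + 2n, ...] below [x].  It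
   drops by the inner sum along a North step and grows by [r t < x] along an
   East step; it returns to its initial value at the end of the path. *)
Lemma east_below_count x :
  (forall t i, t < size w -> nth East w t -> r t + (k.+1 + i) * n + 1 <> x) ->
  \sum_(0 <= t < size w) (~~ nth East w t && (r t < x)) =
  \sum_(0 <= t < size w)
     nth East w t * \sum_(0 <= i < k) (r t + i.+1 * n < x).
Proof.
(* Terms of index at least [x] vanish, so the infinite count can be cut off; the extra [k] leaves
   room to split off the first [k] terms. *)
move=> Hx; pose M := (x + k).+1.
pose c z := \sum_(0 <= i < M) (z + i.+1 * n < x).
have far z i : x <= i -> (z + i.+1 * n < x) = false by move=> ?; nia.
have cE z : c z = (z + n < x) + c (z + n).
  have -> : c (z + n) = \sum_(0 <= i < M.-1) (z + n + i.+1 * n < x).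
    by rewrite {1}/c /M big_nat_recr //= far ?addn0 // leq_addr.
  rewrite /c /M big_nat_recl //= mul1n; congr addn.
  by apply: eq_bigr => i _; congr (nat_of_bool (_ < x)); lia.
have cN t : t < size w -> nth East w t ->
    c (r t) = \sum_(0 <= i < k) (r t + i.+1 * n < x) + c (r t + k * n + 1).
  move=> lt_t wt; rewrite /c (@big_cat_nat _ _ _ k) //=; last by rewrite /M; lia.
  (* After reindexing, corresponding terms compare [z + 1] and [z] with [x]; they differ only if
     [z + 1 = x], which [Hx] excludes. *)
  congr addn; have -> : \sum_(0 <= i < M) (r t + k * n + 1 + i.+1 * n < x) =
      \sum_(k <= i < M + k) (r t + i.+1 * n < x).
    rewrite -[X in _ = \sum_(X <= _ < _) _](add0n k) big_addn addnK; apply: eq_bigr => i _.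
    have := Hx t i lt_t wt; rewrite mulnDl mulSn => H.
    by congr nat_of_bool; rewrite mulSn (mulSn (i + k)) mulnDl; lia.
  rewrite (@big_cat_nat _ _ _ M k (M + k)) ?leq_addr //=; last by rewrite /M; lia.
  rewrite [X in _ = _ + X]big_nat_cond [X in _ = _ + X]big1 ?addn0 // => i.
  by case/andP=> /andP[le_i _] _; rewrite far //; move: le_i; rewrite /M; lia.
suff IH T : T <= size w ->
    \sum_(0 <= t < T) (~~ nth East w t && (r t < x)) + c 0 =
    \sum_(0 <= t < T) nth East w t * \sum_(0 <= i < k) (r t + i.+1 * n < x)
      + c (r T).
  by have := IH _ (leqnn _); rewrite nrank_size => /addIn.
elim: T => [_|T IH lt_T]; first by rewrite !big_geq // nrank0.
rewrite !big_nat_recr //=; have {IH} := IH (ltnW lt_T).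
case wT: (nth East w T) => /=.
  rewrite nrank_north // (cN T) // mul1n; lia.
by rewrite (nrank_east lt_T) ?wT // mul0n (cE (r T.+1)); lia.
Qed.

End DyckRanks.

(** * The array of North ranks *)

Lemma count_ltn_iota i N : i <= N -> count (fun t => t < i) (iota 0 N) = i.
Proof.
move=> le_iN; rewrite -(subnKC le_iN) iotaD count_cat add0n.
rewrite (@eq_in_count _ _ predT (iota 0 i)); last first.
  by move=> t; rewrite mem_iota.
rewrite count_predT size_iota (@eq_in_count _ _ pred0 (iota i _)).
  by rewrite count_pred0 addn0.
by move=> t; rewrite mem_iota => /andP[le_it _]; rewrite ltnNge le_it.
Qed.

(** The order axioms are relative to [l] because ranks separate only the starting vertices of steps:
    the endpoint has the rank of the origin. *)
Lemma index_sort (T : eqType) (leT : rel T) (l : seq T) (u : T) :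
    {in l &, total leT} -> {in l & &, transitive leT} ->
    {in l &, antisymmetric leT} -> uniq l -> u \in l ->
  index u (sort leT l) = count (fun t => ~~ leT u t) l.
Proof.
move=> tot tr anti Ul lu; set s := sort leT l.
have memE : s =i l by exact: mem_sort.
have Us : uniq s by rewrite sort_uniq.
have srt : sorted leT s by apply: (@sort_sorted_in _ (mem l)) => //; apply/allP.
have trs : {in s & &, transitive leT}.
  by move=> x y z; rewrite !memE; apply: tr.
have /seq.permP <- : perm_eq s l by rewrite perm_sort.
rewrite (@eq_in_count _ _ (fun t => index t s < index u s)); last first.
  move=> t st; apply/idP/idP => [nle|lt_tu].
    rewrite ltnNge; apply: contra nle; rewrite leq_eqVlt => /orP[/eqP e|lt_ut].
      have -> : t = u by rewrite -(nth_index u st) -e nth_index ?memE.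
      by have := tot _ _ lu lu; rewrite orbb.
    by apply: (sorted_ltn_index_in trs srt) lt_ut; rewrite // memE.
  apply/negP => le_ut.
  have le_tu : leT t u by apply: (sorted_ltn_index_in trs srt) lt_tu; rewrite // memE.
  have tu : t = u by apply: anti => //; [rewrite -memE | rewrite le_tu].
  by rewrite tu ltnn in lt_tu.
rewrite -[X in _ = count _ X](mkseq_nth u s) count_map.
rewrite (@eq_in_count _ _ (fun t => t < index u s)); last first.
  by move=> t; rewrite mem_iota /= add0n => lt_t; rewrite index_uniq.
by rewrite count_ltn_iota // ltnW // index_mem memE.
Qed.

(** * Standardization and relative order *)

Section Standardize.
Variables p q : nat.
Implicit Types A B : 'M[nat]_(p, q).

Lemma standardize_le A i j i' j' :
  (standardize A i j <= standardize A i' j') = (A i j <= A i' j').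
Proof.
rewrite !mxE; apply/idP/idP => [|le_A]; last first.
  by apply/subset_leq_card/subsetP => ab; rewrite !inE => /leq_trans; apply.
apply: contraLR; rewrite -!ltnNge => lt_A; apply/proper_card/properP; split.
  by apply/subsetP => ab; rewrite !inE => /leq_trans; apply; apply: ltnW.
by exists (i, j); rewrite !inE //= -ltnNge.
Qed.

Lemma standardize_lt A i j i' j' :
  (standardize A i j < standardize A i' j') = (A i j < A i' j').
Proof. by rewrite !ltnNge standardize_le. Qed.

Lemma eq_standardize A B :
  (forall i j i' j', (A i j <= A i' j') = (B i j <= B i' j')) ->
  standardize A = standardize B.
Proof.
move=> AB; apply/matrixP => i j; rewrite !mxE.
by apply: eq_card => ab; rewrite !inE AB.
Qed.

Lemma perm_standardize A :
  (forall i j i' j', A i j = A i' j' -> (i, j) = (i', j')) ->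
  perm_eq [seq standardize A ij.1 ij.2 | ij : 'I_p * 'I_q] (iota 1 (p * q)).
Proof.
move=> injA; set s := [seq _ | _ : _].
have Us : uniq s.
  rewrite map_inj_uniq ?enum_uniq // => -[i j] [i' j'] /= e; apply: injA.
  apply/eqP; rewrite eqn_leq -[A i j <= _](standardize_le A).
  by rewrite -[A i' j' <= _](standardize_le A) e leqnn.
have szs : size s = p * q by rewrite size_map -cardT card_prod !card_ord.
have sub : {subset s <= iota 1 (p * q)}.
  move=> _ /mapP[[i j] _ ->]; rewrite mem_iota add1n ltnS /= mxE.
  apply/andP; split; first by apply/card_gt0P; exists (i, j); rewrite inE.
  by apply: leq_trans (max_card _) _; rewrite card_prod !card_ord.
apply: uniq_perm => //; first exact: iota_uniq.
by apply: (uniq_min_size Us sub _).2; rewrite size_iota szs.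
Qed.

End Standardize.

Definition north_ranks k n (w : lpath) : seq nat :=
  sort leq
    [seq nrank (k * n + 1) n w t | t <- iota 0 (size w) & nth East w t].

(** The bottom entry of a column is one less than the rank at which the corresponding North step
    ends. *)
Definition level_array k n (w : lpath) : 'M[nat]_(k.+1, n) :=
  \matrix_(i < k.+1, j < n) (nth 0 (north_ranks k n w) j + i * n).

(** Intended inverse of [tableau]: letters are indexed from 0 and entries from 1. The entries of a
    tableau stop at [k.+1 * n], so the last letter is East. *)
Definition fuss_word k n (T : 'M[nat]_(k.+1, n)) : lpath :=
  mkseq (fun p => [exists j, T ord0 j == p.+1]) (k.+1 * n + 1).

(** * The tableau carried by a swept path *)

Section SweepTableau.
Variables (k n : nat) (w : lpath).
Local Notation m := (k * n + 1).
Hypotheses (n_gt0 : 0 < n) (w_dyck : dyck m n w).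
Local Notation r := (nrank m n w).
Local Notation s := (north_ranks k n w).
Local Notation Y := (level_array k n w).

Lemma mem_north_ranks z :
  reflect (exists t, [/\ t < size w, nth East w t & z = r t]) (z \in s).
Proof.
rewrite mem_sort; apply: (iffP mapP) => [[t]|[t [lt_t wt ->]]].
  by rewrite mem_filter mem_iota => /andP[wt /andP[_ lt_t]] ->; exists t.
by exists t => //; rewrite mem_filter mem_iota wt.
Qed.

Lemma size_north_ranks : size s = n.
Proof.
rewrite size_sort size_map size_filter; case/dyckP: w_dyck => _ <- _ _.
rewrite -[in RHS](mkseq_nth East w) count_map.
by apply: eq_count => t /=; rewrite eqb_id.
Qed.

Lemma sorted_north_ranks : sorted ltn s.
Proof.
rewrite ltn_sorted_uniq_leq sort_uniq (sort_sorted leq_total) andbT.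
rewrite map_inj_in_uniq ?filter_uniq ?iota_uniq // => t u.
rewrite !mem_filter !mem_iota => /andP[_ /andP[_ lt_t]] /andP[_ /andP[_ lt_u]].
exact: (nrank_inj n_gt0 w_dyck).
Qed.

Lemma north_ranks_lt (j j' : 'I_n) : j < j' -> nth 0 s j < nth 0 s j'.
Proof.
move=> lt_j; apply: (sorted_ltn_nth ltn_trans _ sorted_north_ranks) => //.
  by rewrite inE size_north_ranks.
by rewrite inE size_north_ranks.
Qed.

Lemma nth_north_ranks (j : 'I_n) :
  exists t, [/\ t < size w, nth East w t & nth 0 s j = r t].
Proof. by apply/mem_north_ranks/mem_nth; rewrite size_north_ranks. Qed.

Lemma north_ranks_nth t : t < size w -> nth East w t ->
  exists j : 'I_n, nth 0 s j = r t.
Proof.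
move=> lt_t wt; have rs : r t \in s by apply/mem_north_ranks; exists t.
have lt_i : index (r t) s < n by rewrite -index_mem size_north_ranks in rs.
by exists (Ordinal lt_i); rewrite /= nth_index.
Qed.

Lemma north_ranks_head (j0 : 'I_n) : j0 = 0 :> nat -> nth 0 s j0 = 0.
Proof.
move=> j00; have lt0 : 0 < size w by rewrite (size_dyck w_dyck) addn1.
have [j] := north_ranks_nth lt0 (nth_head_dyck n_gt0 w_dyck).
rewrite nrank0 => sj; case: (posnP j) => [j_0|j_gt0]; first by move: sj; rewrite j00 j_0.
by have := @north_ranks_lt j0 j; rewrite j00 j_gt0 sj => /(_ isT).
Qed.

Lemma sum_north_ranks (F : nat -> nat) :
  \sum_(j < n) F (nth 0 s j) = \sum_(0 <= t < size w) nth East w t * F (r t).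
Proof.
rewrite -(big_mkord predT (fun j => F (nth 0 s j))) -{1}size_north_ranks.
rewrite -(big_nth 0 predT F) (perm_big _ (permEl (perm_sort _ _))) /=.
rewrite big_map big_filter big_mkcond /index_iota subn0.
by apply: eq_bigr => t _; case: nth; rewrite ?mul1n.
Qed.

Lemma north_ranks_residue (j j' : 'I_n) :
  nth 0 s j = nth 0 s j' %[mod n] -> j = j'.
Proof.
have [t [lt_t wt e]] := nth_north_ranks j.
have [t' [lt_t' wt' e']] := nth_north_ranks j'; rewrite e e' => eq_r.
have tt' := north_same_residue n_gt0 w_dyck lt_t lt_t' wt wt' eq_r.
apply/val_inj; case: (ltngtP j j') => // /north_ranks_lt;
  by rewrite e e' tt' ltnn.
Qed.

(** At the starting rank of a step this is the position, from 0, of that step in the swept path. *)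
Definition ranks_below x := \sum_(0 <= t < size w) (r t < x).

Lemma ranks_belowS t : t < size w -> ranks_below (r t).+1 = (ranks_below (r t)).+1.
Proof.
move=> lt_t; rewrite /ranks_below !big_mkord (bigD1 (Ordinal lt_t)) //= ltnSn.
rewrite [in RHS](bigD1 (Ordinal lt_t)) //= ltnn add0n add1n; congr S.
apply: eq_bigr => u neq_u; rewrite ltnS leq_eqVlt; case: eqP => // e.
have uE : u = Ordinal lt_t.
  by apply/val_inj/(nrank_inj n_gt0 w_dyck); rewrite //= ltn_ord.
by rewrite uE eqxx in neq_u.
Qed.

Lemma ranks_below_mono x y : x <= y -> ranks_below x <= ranks_below y.
Proof.
move=> le_xy; apply: leq_sum => t _; case: ltnP => // lt_x.
by rewrite (leq_trans lt_x le_xy).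
Qed.

Lemma ranks_below_lt t x : t < size w -> (ranks_below (r t) < ranks_below x) = (r t < x).
Proof.
move=> lt_t; case: (ltnP (r t) x) => [/ranks_below_mono|/ranks_below_mono].
  by rewrite ranks_belowS // => ->.
by rewrite ltnNge => ->.
Qed.

Lemma ranks_below_inj t u : t < size w -> u < size w ->
  ranks_below (r t) = ranks_below (r u) -> t = u.
Proof.
move=> lt_t lt_u e; apply: (nrank_inj n_gt0 w_dyck) => //.
have := ranks_below_lt (r u) lt_t; have := ranks_below_lt (r t) lt_u.
by rewrite e ltnn; case: ltngtP.
Qed.

Lemma index_sweep u : u < size w ->
  index u (sort (fun i j => (vrank m n w i <= vrank m n w j)%R) (iota 0 (size w)))
  = ranks_below (r u).
Proof.
move=> lt_u; pose leT i j := (vrank m n w i <= vrank m n w j)%R.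
have leE t t' : t < size w -> t' < size w -> leT t t' = (r t <= r t').
  move=> lt lt'; rewrite /leT (vrank_nrank w_dyck (ltnW lt)).
  by rewrite (vrank_nrank w_dyck (ltnW lt')).
rewrite index_sort ?iota_uniq ?mem_iota //.
- rewrite /ranks_below -sum1_count big_mkcond /index_iota subn0 /=.
  rewrite big_seq [RHS]big_seq; apply: eq_bigr => t; rewrite mem_iota => /andP[_ lt_t].
  by rewrite -/(leT u t) leE // -ltnNge; case: ltnP.
- move=> t t'; rewrite !mem_iota /= => lt_t lt_t'.
  by rewrite -!/(leT _ _) !leE // leq_total.
- move=> t t' t''; rewrite !mem_iota /= => lt_t lt_t' lt_t''.
  by rewrite -!/(leT _ _) !leE //; apply: leq_trans.
- move=> t t'; rewrite !mem_iota /= => lt_t lt_t'.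
  rewrite -!/(leT _ _) !leE // -eqn_leq => /eqP; exact: (nrank_inj n_gt0 w_dyck).
Qed.

Lemma size_sweep : size (sweep m n w) = size w.
Proof. by rewrite size_map size_sort size_iota. Qed.

Lemma nth_sweep u : u < size w ->
  nth East (sweep m n w) (ranks_below (r u)) = nth East w u.
Proof.
move=> lt_u; rewrite -index_sweep // (nth_map 0); last first.
  by rewrite index_mem mem_sort mem_iota.
by rewrite nth_index // mem_sort mem_iota.
Qed.

Lemma ranks_below_surj p : p < size w ->
  exists2 u, u < size w & ranks_below (r u) = p.
Proof.
move=> lt_p; set l := sort (fun i j => (vrank m n w i <= vrank m n w j)%R)
  (iota 0 (size w)).
have szl : size l = size w by rewrite size_sort size_iota.
have : nth 0 l p \in l by rewrite mem_nth ?szl.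
rewrite mem_sort mem_iota => /andP[_ lt_u]; exists (nth 0 l p) => //.
by rewrite -index_sweep // index_uniq ?szl // sort_uniq iota_uniq.
Qed.

(* The excluded coincidence in [east_below_count] would force two North steps
   to start at the same height, since heights are ranks modulo [n]. *)
Lemma standardize_level i j :
  standardize Y i j = ranks_below (nth 0 s j + i * n).+1.
Proof.
set y := nth 0 s j + i * n.
have -> : standardize Y i j =
    \sum_(b < n) \sum_(a < k.+1) (nth 0 s b + a * n < y.+1).
  rewrite mxE -sum1_card big_mkcond /= exchange_big pair_bigA /=.
  by apply: eq_bigr => ab _; rewrite inE !mxE ltnS; case: leqP.
rewrite (sum_north_ranks (fun z => \sum_(a < k.+1) (z + a * n < y.+1))).
have [t0 [lt_t0 wt0 e0]] := nth_north_ranks j.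
have Hx t c : t < size w -> nth East w t -> r t + (k.+1 + c) * n + 1 <> y.+1.
  move=> lt_t wt; rewrite addn1 /y e0 => -[e].
  have tt0 : t = t0.
    apply: (north_same_residue n_gt0 w_dyck) => //.
    by rewrite -(modnMDl (k.+1 + c) (r t)) addnC e addnC modnMDl.
  move: e; rewrite tt0 => /addnI /eqP; rewrite eqn_pmul2r // => /eqP e.
  by have := ltn_ord i; rewrite -e; lia.
have := east_below_count n_gt0 w_dyck Hx.
set W := \sum_(0 <= t < _) _; set S := \sum_(0 <= t < _) _ => WS.
(* The row [a = 0] counts the North steps of rank at most [y]; the other rows add up to [S], which
   by [WS] counts the East steps. *)
transitivity (\sum_(0 <= t < size w) (nth East w t && (r t < y.+1)) + S).
  rewrite /S -big_split; apply: eq_bigr => t _ /=.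
  rewrite big_ord_recl mul0n addn0 mulnDr -mulnb big_mkord; congr (_ + _ * _).
rewrite -WS /W -big_split; apply: eq_bigr => t _ /=.
by case: nth; rewrite //= addn0.
Qed.

(** Vertical neighbours of [level_array] differ by exactly [n], and distinct entries of one column
    by at least [n], so no column has two entries strictly between such neighbours. Distinct columns
    have distinct residues modulo [n], so no entry is repeated. *)
Lemma fuss_standardize_level : fuss_tableau (standardize Y).
Proof.
split.
- apply: perm_standardize => i j i' j'; rewrite !mxE => e.
  have jj' : j = j'.
    apply: north_ranks_residue.
    by rewrite -(modnMDl i (nth 0 s j)) addnC e addnC modnMDl.
  move: e; rewrite jj' => /addnI /eqP; rewrite eqn_pmul2r // => /eqP /val_inj ->.
  by [].
- by move=> i j1 j2 lt_j; rewrite standardize_lt !mxE ltn_add2r north_ranks_lt.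
- by move=> i1 i2 j lt_i; rewrite standardize_lt !mxE ltn_add2l ltn_pmul2r.
- move=> i1 i2 j e r0 s0 l []; rewrite !standardize_lt !mxE e mulSn.
  rewrite ltn_add2l ltn_pmul2r // => lt1 lt2 lt3.
  have : r0.+1 * n <= s0 * n by rewrite leq_pmul2r.
  by rewrite mulSn; lia.
Qed.

(** The top entry of column [j] is the swept position, counted from 1, of the North step with the
    rank of index [j] in [s]. *)
Lemma sweep_fuss_word : sweep m n w = fuss_word (standardize Y).
Proof.
apply: (@eq_from_nth _ East).
  by rewrite size_sweep size_mkseq (size_dyck w_dyck).
move=> p; rewrite size_sweep => lt_p.
have [u lt_u pE] := ranks_below_surj lt_p.
rewrite nth_mkseq -?(size_dyck w_dyck) // -{1}pE nth_sweep //.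
apply/idP/existsP => [wu|[j]].
  have [j sj] := north_ranks_nth lt_u wu; exists j.
  by rewrite standardize_level mul0n addn0 sj ranks_belowS // pE.
have [t [lt_t wt sj]] := nth_north_ranks j; rewrite standardize_level mul0n addn0 sj.
rewrite ranks_belowS // eqSS -pE => /eqP tu.
by rewrite -(ranks_below_inj lt_t lt_u tu).
Qed.

End SweepTableau.

(** * The filling algorithm *)

Lemma sorted_ltn_last (l : seq nat) x : sorted ltn l -> x \in l -> x <= last 0 l.
Proof.
case: l => // a l; rewrite (sorted_pairwise ltn_trans); case/lastP: l => [_|l b].
  by rewrite inE => /eqP ->.
rewrite -rcons_cons pairwise_rcons last_rcons => /andP[/allP lt_b _].
by rewrite mem_rcons inE => /predU1P[-> //|/lt_b /ltnW].
Qed.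

Lemma filter_leqS (l : seq nat) i : sorted ltn l -> i.+1 \in l ->
  [seq z <- l | z <= i.+1] = rcons [seq z <- l | z <= i] i.+1.
Proof.
move=> srt li; apply: (irr_sorted_eq ltn_trans ltnn).
- exact: sorted_filter ltn_trans _ _ srt.
- rewrite (sorted_pairwise ltn_trans) pairwise_rcons.
  rewrite -(sorted_pairwise ltn_trans) (sorted_filter ltn_trans) // andbT.
  by apply/allP => z; rewrite mem_filter => /andP[].
- move=> z; rewrite mem_rcons inE !mem_filter leq_eqVlt ltnS.
  by case: eqP => // ->; rewrite li.
Qed.

(** Comparing columns by their lowest entries is not antisymmetric on column indices, so uniqueness
    of the minimum is assumed directly. *)
Lemma head_sort (T : eqType) (leT : rel T) (l : seq T) x0 b :
    total leT -> transitive leT -> b \in l ->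
    (forall x, x \in l -> leT x b -> x = b) -> head x0 (sort leT l) = b.
Proof.
move=> tot tr lb Hb; have := sort_sorted tot l.
have : b \in sort leT l by rewrite mem_sort.
have : forall x, x \in sort leT l -> x \in l by move=> x; rewrite mem_sort.
case: (sort leT l) => // h s sub + /= /(order_path_min tr)/allP le_h.
rewrite inE => /predU1P[-> //|/le_h le_hb].
by apply: Hb => //; apply: sub; rewrite mem_head.
Qed.

Section Filling.
Variables (k n : nat) (T : 'M[nat]_(k.+1, n)).
Hypotheses (n_gt0 : 0 < n) (T_fuss : fuss_tableau T).

Lemma fuss_inj i j i' j' : T i j = T i' j' -> (i, j) = (i', j').
Proof.
case: T_fuss => pT _ _ _ e.
suff /injectiveP inj : injectiveb (fun ij : 'I_k.+1 * 'I_n => T ij.1 ij.2).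
  exact: inj.
by rewrite /injectiveb /dinjectiveb (perm_uniq pT) iota_uniq.
Qed.

Lemma fuss_bound i j : 0 < T i j <= k.+1 * n.
Proof.
case: T_fuss => pT _ _ _.
have : T i j \in [seq T ij.1 ij.2 | ij : 'I_k.+1 * 'I_n].
  by apply/mapP; exists (i, j); rewrite ?mem_enum.
by rewrite (perm_mem pT) mem_iota add1n ltnS.
Qed.

Lemma fuss_surj z : 0 < z <= k.+1 * n -> exists i j, T i j = z.
Proof.
case: T_fuss => pT _ _ _ bz.
have : z \in iota 1 (k.+1 * n) by rewrite mem_iota add1n ltnS.
by rewrite -(perm_mem pT) => /mapP[[i j] _ ->]; exists i, j.
Qed.

Lemma fuss_col_lt i i' j : (T i j < T i' j) = (i < i').
Proof.
case: T_fuss => _ _ colT _.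
case: (ltngtP i i') => [lt_i|lt_i|/val_inj ->]; last exact: ltnn.
  exact: colT.
by rewrite ltnNge ltnW // colT.
Qed.

Definition fuss_col (j : 'I_n) : seq nat := [seq T i j | i : 'I_k.+1].

Lemma size_fuss_col j : size (fuss_col j) = k.+1.
Proof. by rewrite size_map -cardT card_ord. Qed.

Lemma nth_fuss_col (i : 'I_k.+1) j : nth 0 (fuss_col j) i = T i j.
Proof. by rewrite (nth_map i) ?nth_ord_enum // size_enum_ord. Qed.

Lemma mem_fuss_col z j : reflect (exists i, T i j = z) (z \in fuss_col j).
Proof.
apply: (iffP mapP) => [[i _ ->]|[i <-]]; first by exists i.
by exists i; rewrite ?mem_enum.
Qed.

Lemma sorted_fuss_col j : sorted ltn (fuss_col j).
Proof.
rewrite (sorted_pairwise ltn_trans); apply/(pairwiseP 0) => a b.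
rewrite !inE size_fuss_col => lt_a lt_b lt_ab.
by rewrite (nth_fuss_col (Ordinal lt_a)) (nth_fuss_col (Ordinal lt_b)) fuss_col_lt.
Qed.

(** The state that the algorithm should have reached once [1] to [i] are placed. *)
Definition partial_filling i : seq (seq nat) :=
  [seq [seq z <- fuss_col j | z <= i] | j : 'I_n].

Lemma size_partial_filling i : size (partial_filling i) = n.
Proof. by rewrite size_map -cardT card_ord. Qed.

Lemma nth_partial_filling i (j : 'I_n) :
  nth [::] (partial_filling i) j = [seq z <- fuss_col j | z <= i].
Proof. by rewrite (nth_map j) ?nth_ord_enum // size_enum_ord. Qed.

Lemma put_partial_filling i a b : T a b = i.+1 ->
  put (partial_filling i) b i.+1 = partial_filling i.+1.
Proof.
move=> Tab; apply: (@eq_from_nth _ [::]).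
  rewrite size_set_nth !size_partial_filling; apply/maxn_idPr; exact: ltn_ord.
rewrite size_set_nth size_partial_filling.
have /maxn_idPr -> : b < n by [].
move=> j lt_j; rewrite nth_set_nth /=; case: eqP => [->|/eqP neq_j].
  rewrite !nth_partial_filling filter_leqS ?sorted_fuss_col //.
  by apply/mem_fuss_col; exists a.
rewrite !(nth_partial_filling _ (Ordinal lt_j)); apply: eq_in_filter => z.
case/mem_fuss_col=> c Tc; rewrite [RHS]leq_eqVlt ltnS; case: eqP => // zi.
case/eqP: neq_j; have [_ ->] : (a, b) = (c, Ordinal lt_j); last by [].
by apply: fuss_inj; rewrite Tab Tc.
Qed.

Lemma nth_fuss_word p : p < k.+1 * n + 1 ->
  nth East (fuss_word T) p = [exists j, T ord0 j == p.+1].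
Proof. by move=> lt_p; rewrite nth_mkseq. Qed.

(** Columns increase, so column [b] is still empty; rows increase, so every column to its left
    already has its top entry. *)
Lemma leftmost_empty_filling i (b : 'I_n) : T ord0 b = i.+1 ->
  leftmost_empty (partial_filling i) = b.
Proof.
move=> Tb; have [_ rowT _ _] := T_fuss.
have bE : nth [::] (partial_filling i) b = [::].
  rewrite nth_partial_filling; apply/eqP; rewrite -size_eq0 size_filter -leqn0.
  rewrite -ltnS ltnS leqNgt -has_count; apply/hasPn => z /mem_fuss_col[a <-].
  rewrite -ltnNge -Tb; case: (posnP a) => [a0|a_gt0].
    by rewrite (_ : a = ord0) //; apply: val_inj.
  by rewrite ltnW // fuss_col_lt.
rewrite /leftmost_empty; set e := index _ _.
have [||//] := ltngtP e b => [lt_e|lt_b].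
  have lt_en := ltn_trans lt_e (ltn_ord b).
  have : nth [::] (partial_filling i) e = [::].
    by apply: nth_index; rewrite -index_mem size_partial_filling.
  rewrite (nth_partial_filling _ (Ordinal lt_en)) => /eqP.
  rewrite -size_eq0 size_filter -leqn0 leqNgt -has_count => /hasPn/(_ (T ord0 (Ordinal lt_en))).
  rewrite -ltnNge -Tb leqNgt rowT // => H.
  suff: T ord0 (Ordinal lt_en) \in fuss_col (Ordinal lt_en) by move/H.
  by apply/mem_fuss_col; exists ord0.
by have := before_find [::] lt_b; rewrite bE /= eqxx.
Qed.

(** An active column is not full, so there is an entry under its lowest one, and it is not yet
    placed. *)
Lemma active_filling i (j : 'I_n) : active k (partial_filling i) j ->
  exists r r' : 'I_k.+1, [/\ r' = r.+1 :> nat,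
    lowest (partial_filling i) j = T r j & T r j <= i < T r' j].
Proof.
rewrite /active /lowest nth_partial_filling; set f := [seq _ <- _ | _].
have srt : sorted ltn f by apply: sorted_filter ltn_trans _ _ (sorted_fuss_col j).
case/andP=> f_gt0 lt_f.
have : last 0 f \in f by case: (f) f_gt0 => // a l _; exact: mem_last.
rewrite mem_filter => /andP[le_i /mem_fuss_col[r Tr]].
have lt_r : r.+1 < k.+1.
  rewrite ltnNge; apply/negP => le_r; move: lt_f.
  rewrite size_filter -(size_fuss_col j) ltnNge => /negP; apply.
  suff: all (fun z => z <= i) (fuss_col j) by rewrite all_count => /eqP ->.
  apply/allP => z /mem_fuss_col[a <-].
  apply: leq_trans le_i; rewrite -Tr leqNgt fuss_col_lt -leqNgt.
  by have := ltn_ord a; lia.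
exists r, (Ordinal lt_r); rewrite Tr le_i; split=> //=.
rewrite ltnNge; apply/negP => le_T.
have : T (Ordinal lt_r) j <= last 0 f.
  by apply: sorted_ltn_last => //; rewrite mem_filter le_T; apply/mem_fuss_col; exists (Ordinal lt_r).
by rewrite -Tr leqNgt fuss_col_lt /= ltnSn.
Qed.

Lemma fill_active i (a a' : 'I_k.+1) (b : 'I_n) :
    a = a'.+1 :> nat -> T a b = i.+1 ->
  active k (partial_filling i) b /\ lowest (partial_filling i) b = T a' b.
Proof.
move=> aE Tab; rewrite /active /lowest nth_partial_filling; set f := [seq _ <- _ | _].
have srt : sorted ltn f by apply: sorted_filter ltn_trans _ _ (sorted_fuss_col b).
have fa' : T a' b \in f.
  rewrite mem_filter -ltnS -Tab fuss_col_lt aE ltnSn.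
  by apply/mem_fuss_col; exists a'.
split.
  apply/andP; split; first by case: (f) fa'.
  rewrite ltnNge -(size_fuss_col b) size_filter; apply/negP => le_f.
  have /allP/(_ (T a b)) : all (fun z => z <= i) (fuss_col b).
    by rewrite all_count eqn_leq count_size.
  by rewrite Tab ltnn => H; apply/notF/H; apply/mem_fuss_col; exists a.
apply/eqP; rewrite eqn_leq (sorted_ltn_last srt fa') andbT.
have : last 0 f \in f by case: (f) fa' => // c l _; exact: mem_last.
rewrite mem_filter => /andP[le_i /mem_fuss_col[c Tc]]; rewrite -Tc in le_i *.
have : T c b < T a b by rewrite Tab.
rewrite fuss_col_lt aE ltnS => le_c.
by rewrite leqNgt fuss_col_lt -leqNgt.
Qed.

(** If another active column had a smaller lowest entry, that entry and the one due below it would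
    enclose both [T a' b] and [T a b = i.+1], against the last condition of [fuss_tableau]. *)
Lemma smallest_active_filling i (a a' : 'I_k.+1) (b : 'I_n) :
  a = a'.+1 :> nat -> T a b = i.+1 -> smallest_active k (partial_filling i) = b.
Proof.
move=> aE Tab; have [act_b low_b] := fill_active aE Tab.
apply: head_sort.
- by move=> j1 j2; apply: leq_total.
- by move=> j1 j2 j3; apply: leq_trans.
- by rewrite mem_filter act_b mem_iota size_partial_filling ltn_ord.
move=> j; rewrite mem_filter mem_iota size_partial_filling add0n low_b.
case/andP=> act_j /andP[_ lt_j].
have [r [r' [r'E]]] := @active_filling i (Ordinal lt_j) act_j.
move=> /= -> /andP[le_r lt_r'] le_ra'; case: (j =P b) => // neq_j.
have [_ _ _ nest] := T_fuss.
case: (nest r r' (Ordinal lt_j) r'E a' a b); split.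
- rewrite ltn_neqAle le_ra' andbT; apply/eqP => /fuss_inj [_ e].
  by case: neq_j; rewrite -e.
- by rewrite fuss_col_lt aE.
- rewrite Tab ltn_neqAle lt_r' andbT -Tab; apply/eqP => /fuss_inj [_ e].
  by case: neq_j; rewrite e.
Qed.

Lemma fill_step_partial i : i < k.+1 * n ->
  fill_step k (fuss_word T) (partial_filling i) i.+1 = partial_filling i.+1.
Proof.
move=> lt_i; have [a [b Tab]] := @fuss_surj i.+1 lt_i.
rewrite /fill_step -(put_partial_filling Tab) /= nth_fuss_word; last lia.
congr put; case: (posnP a) => [a0|a_gt0].
  have aE : a = ord0 by apply: val_inj.
  rewrite aE in Tab; rewrite (leftmost_empty_filling Tab) ifT //.
  by rewrite eqb_id; apply/existsP; exists b; apply/eqP.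
rewrite ifF; last first.
  apply/negbTE; rewrite eqb_id; apply/existsP => -[j /eqP]; rewrite -Tab.
  by case/fuss_inj => a0 _; rewrite -a0 in a_gt0.
have lt_a' : a.-1 < k.+1 by apply: leq_ltn_trans (leq_pred _) (ltn_ord a).
by apply: (@smallest_active_filling i a (Ordinal lt_a')); rewrite //= prednK.
Qed.

Lemma tableau_fuss_word : tableau k n (fuss_word T) = T.
Proof.
have part0 : partial_filling 0 = nseq n [::].
  apply: (@eq_from_nth _ [::]); rewrite size_partial_filling ?size_nseq // => j lt_j.
  rewrite nth_nseq lt_j (nth_partial_filling _ (Ordinal lt_j)).
  apply/eqP; rewrite -size_eq0 size_filter -leqn0 leqNgt -has_count.
  apply/hasPn => z /mem_fuss_col[a <-]; rewrite -ltnNge.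
  by case/andP: (fuss_bound a (Ordinal lt_j)).
(* The placement of [1] built into [fill] agrees with an ordinary step: [1] must be a top entry, and
   all columns are empty. *)
have init : put (nseq n [::]) 0 1 = partial_filling 1.
  have lt0 : 0 < k.+1 * n by rewrite muln_gt0.
  rewrite -(fill_step_partial lt0) part0 /fill_step.
  have [a [b Tab]] := @fuss_surj 1 lt0; rewrite nth_fuss_word ?addn1 // ifT.
    by rewrite /leftmost_empty; case: (n) n_gt0.
  have a0 : a = ord0.
    apply: val_inj; case: (posnP a) => // a_gt0.
    have := fuss_bound ord0 b; have := fuss_col_lt ord0 a b.
    by rewrite a_gt0 Tab ltnS leqn0 => /eqP ->.
  by rewrite eqb_id; apply/existsP; exists b; rewrite -Tab a0.
have fillE q : q < k.+1 * n ->
    foldl (fill_step k (fuss_word T)) (partial_filling 1) (iota 2 q) =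
    partial_filling q.+1.
  elim: q => // q IH lt_q; rewrite -[X in iota 2 X]addn1 iotaD cats1 foldl_rcons IH 1?ltnW //.
  exact: fill_step_partial.
have fill_end : fill k n (fuss_word T) = partial_filling (k.+1 * n).
  have -> : k.+1 * n = (k * n + 1 + n - 2).+1 by rewrite mulSn; lia.
  by rewrite /fill init fillE // mulSn; lia.
apply/matrixP => i j; rewrite mxE fill_end nth_partial_filling.
rewrite (eq_in_filter (a2 := predT)) ?filter_predT ?nth_fuss_col // => z.
by case/mem_fuss_col => a <-; case/andP: (fuss_bound a j).
Qed.

Lemma size_fuss_word : size (fuss_word T) = k.+1 * n + 1.
Proof. exact: size_mkseq. Qed.

Lemma ycoord_fuss_word t : t <= k.+1 * n + 1 ->
  ycoord (fuss_word T) t = \sum_(j < n) (T ord0 j <= t).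
Proof.
move=> le_t; rewrite /ycoord /fuss_word /mkseq -map_take take_iota.
have /minn_idPl -> := le_t; rewrite count_map.
set tops := [seq T ord0 j | j : 'I_n].
have -> : \sum_(j < n) (T ord0 j <= t) = count (fun z => z <= t) tops.
  rewrite count_map -sum1_count big_enum_cond [RHS]big_mkcond /=.
  by apply: eq_bigr => j _; case: leqP.
transitivity (count (mem tops) (iota 1 t)).
  rewrite -[1]addn0 iotaDl count_map; apply: eq_count => p /=; rewrite eqb_id.
  apply/existsP/mapP => [[j /eqP e]|[j _ e]].
    by exists j; rewrite ?mem_enum // e.
  by exists j; rewrite -e.
rewrite -!size_filter; apply/perm_size/uniq_perm.
- by rewrite filter_uniq ?iota_uniq.
- rewrite filter_uniq // map_inj_uniq ?enum_uniq // => j j'.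
  by case/fuss_inj.
move=> z; rewrite !mem_filter mem_iota add1n ltnS andbC /=.
rewrite [RHS]andbC; case: (boolP (z \in tops)) => [/mapP[j _ ->]|_]; rewrite ?andbF //.
by case/andP: (fuss_bound ord0 j) => -> _; rewrite andbT.
Qed.

(** Each number up to [t] lies in a column whose top entry is at most [t], and a column has [k.+1]
    entries; so [t <= k.+1 * y], that is [x <= k * y]. Only the endpoint escapes this bound, and its
    rank is 0. *)
Lemma dyck_fuss_word : dyck (k * n + 1) n (fuss_word T).
Proof.
have yN : ycoord (fuss_word T) (k.+1 * n + 1) = n.
  rewrite ycoord_fuss_word // (eq_bigr (fun _ => 1)) ?sum1_card ?card_ord // => j _.
  by case/andP: (fuss_bound ord0 j) => _ le_T; rewrite (leq_trans le_T) ?leq_addr.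
have xN := coord_sum (leqnn (size (fuss_word T))).
rewrite size_fuss_word yN mulSn in xN.
have {}xN : xcoord (fuss_word T) (k.+1 * n + 1) = k * n + 1 by rewrite mulSn; lia.
apply/dyckP; split.
- by rewrite -xN /xcoord take_oversize // size_fuss_word.
- by rewrite -[RHS]yN /ycoord take_oversize // size_fuss_word.
- by rewrite size_fuss_word mulSn; lia.
move=> t; rewrite size_fuss_word addn1 leq_eqVlt ltnS => /predU1P[->|le_t].
  by rewrite -addn1 xN yN mulnC.
have xy := @coord_sum (fuss_word T) t.
rewrite size_fuss_word addn1 in xy; have {}xy := xy (leqW le_t).
suff : t <= k.+1 * ycoord (fuss_word T) t by rewrite -{1}xy; nia.
rewrite ycoord_fuss_word; last lia.
have tE : t = \sum_(j < n) \sum_(i < k.+1) (T i j <= t).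
  have [/seq.permP/(_ (fun z => z <= t)) cnt _ _ _] := T_fuss.
  rewrite -[X in iota X](addn0 1) iotaDl [RHS]count_map in cnt.
  rewrite [RHS]count_ltn_iota // count_map in cnt.
  rewrite -[LHS]cnt -sum1_count big_enum_cond big_mkcond /= exchange_big pair_bigA /=.
  by apply: eq_bigr => ij _; case: leqP.
rewrite [X in X <= _]tE big_distrr; apply: leq_sum => j _ /=.
case: (leqP (T ord0 j) t) => [_|lt_t].
  rewrite /= muln1; apply: (@leq_trans (\sum_(i < k.+1) 1)).
    by apply: leq_sum => i _; apply: leq_b1.
  by rewrite sum1_card card_ord.
rewrite muln0 leqn0 big1 // => i _; rewrite leqNgt (leq_trans lt_t) //.
by rewrite leqNgt fuss_col_lt.
Qed.

End Filling.

(** * Bijectivity of the sweep map *)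

(** Here [c] is the number of values missed by [h] below [q1], and likewise below [q2]; this number
    grows strictly when passing a missed value. *)
Lemma count_below_inj n (h : 'I_n -> nat) c q1 q2 : injective h ->
    (forall j, h j <> q1) -> (forall j, h j <> q2) ->
    q1 = \sum_j (h j < q1) + c -> q2 = \sum_j (h j < q2) + c ->
  q1 = q2.
Proof.
move=> inj_h.
have leS q : \sum_j (h j < q.+1) <= (\sum_j (h j < q)).+1.
  case: (pickP (fun j => h j == q)) => [j0 /eqP hj0|none].
    rewrite (bigD1 j0) //= [in X in _ <= X](bigD1 j0) //= hj0 ltnSn ltnn add0n add1n.
    rewrite ltnS; apply: leq_sum => j neq_j; rewrite ltnS [h j <= q]leq_eqVlt.
    by case: (h j =P q) => // hj; case/eqP: neq_j; apply: inj_h; rewrite hj.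
  by apply: leqW; apply: leq_sum => j _; rewrite ltnS [h j <= q]leq_eqVlt none.
have leD q d : \sum_j (h j < q + d) <= \sum_j (h j < q) + d.
  elim: d => [|d IH]; first by rewrite !addn0.
  by rewrite !addnS; apply: leq_trans (leS _) _; rewrite ltnS.
have main a b : (forall j, h j <> a) -> a < b ->
    a = \sum_j (h j < a) + c -> b = \sum_j (h j < b) + c -> False.
  move=> ha lt_ab ea eb; have := leD a.+1 (b - a.+1); rewrite subnKC //.
  have -> : \sum_j (h j < a.+1) = \sum_j (h j < a).
    by apply: eq_bigr => j _; rewrite ltnS leq_eqVlt; case: eqP => // /ha.
  lia.
move=> h1 h2 e1 e2; case: (ltngtP q1 q2) => // [lt|lt].
- by case: (main _ _ h1 lt).
- by case: (main _ _ h2 lt).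
Qed.

Section SweepInverse.
Variables (k n : nat).
Local Notation m := (k * n + 1).
Hypothesis n_gt0 : 0 < n.

Lemma tableau_sweep w : dyck m n w ->
  tableau k n (sweep m n w) = standardize (level_array k n w).
Proof.
move=> w_dyck; rewrite sweep_fuss_word //.
by apply: tableau_fuss_word => //; apply: fuss_standardize_level.
Qed.

Lemma dyck_sweep w : dyck m n w -> dyck m n (sweep m n w).
Proof.
move=> w_dyck; rewrite sweep_fuss_word //.
by apply: dyck_fuss_word => //; apply: fuss_standardize_level.
Qed.

Lemma ranks_below_size w t : dyck m n w -> t < size w ->
  ranks_below k n w (nrank m n w t) < size w.
Proof.
move=> w_dyck lt_t; rewrite -ranks_belowS //.
apply: (@leq_trans (\sum_(0 <= u < size w) 1)).
  by apply: leq_sum => u _; apply: leq_b1.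
by rewrite sum_nat_const_nat muln1 subn0.
Qed.

(** A North step raises the rank by [k * n + 1], so the ranks below its end are those at most the
    bottom entry of its column in [level_array]. *)
Lemma north_target w t (j : 'I_n) : dyck m n w -> t < size w -> nth East w t ->
    standardize (level_array k n w) ord0 j = (ranks_below k n w (nrank m n w t)).+1 ->
  ranks_below k n w (nrank m n w t.+1) = standardize (level_array k n w) ord_max j.
Proof.
move=> w_dyck lt_t wt; have [j' sj'] := north_ranks_nth w_dyck lt_t wt.
rewrite -ranks_belowS // -sj' => e.
have e' : standardize (level_array k n w) ord0 j' =
    ranks_below k n w (nth 0 (north_ranks k n w) j').+1.
  by rewrite standardize_level // mul0n addn0.
have [jj'] : (ord0, j) = (ord0 : 'I_k.+1, j').
  apply: (fuss_inj (fuss_standardize_level n_gt0 w_dyck)).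
  by rewrite e e'.
by rewrite jj' standardize_level // sj' (nrank_north n_gt0 w_dyck) //
  [X in ranks_below _ _ _ X = _]addn1.
Qed.

(* East steps shift all ranks by the same amount, so the number of East steps
   starting below [t] is the number of vertices below [t.+1] entered by an East
   step; the vertices entered by a North step have the bottom row as positions. *)
Lemma east_target w t : dyck m n w -> t.+1 < size w -> ~~ nth East w t ->
  let q := ranks_below k n w (nrank m n w t.+1) in
  let p := ranks_below k n w (nrank m n w t) in
  let T := standardize (level_array k n w) in
  (forall j, T ord_max j <> q) /\
  q = \sum_j (T ord_max j < q) + \sum_(0 <= u < size w) (~~ nth East (sweep m n w) u && (u < p)).
Proof.
move=> w_dyck lt_t1 wt q p T; have lt_t := ltnW lt_t1.
have TE u (j : 'I_n) : u < size w -> nth East w u -> nth 0 (north_ranks k n w) j = nrank m n w u ->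
    T ord_max j = ranks_below k n w (nrank m n w u.+1).
  by move=> lt_u wu sj; rewrite /T standardize_level // sj (nrank_north n_gt0 w_dyck) //
    [X in _ = ranks_below _ _ _ X]addn1.
(* A North step ends at positive rank, so it cannot be the last step. *)
have u1 u : u < size w -> nth East w u -> u.+1 < size w.
  move=> lt_u wu; rewrite ltn_neqAle lt_u andbT; apply/eqP => uN.
  have := nrank_north n_gt0 w_dyck lt_u wu; rewrite uN (nrank_size w_dyck); lia.
split=> [j e|].
  have [u [lt_u wu sj]] := nth_north_ranks w_dyck j.
  rewrite (TE u j) // in e.
  have [ut] := ranks_below_inj n_gt0 w_dyck (u1 _ lt_u wu) lt_t1 e.
  by rewrite -ut wu in wt.
have -> : \sum_(0 <= u < size w) (~~ nth East (sweep m n w) u && (u < p)) =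
   \sum_(0 <= u < size w) (~~ nth East w u && (nrank m n w u < nrank m n w t)).
  rewrite !big_mkord.
  pose pos (u : 'I_(size w)) := Ordinal (ranks_below_size w_dyck (ltn_ord u)).
  have pos_inj : injective pos.
    move=> u v [] /(ranks_below_inj n_gt0 w_dyck (ltn_ord u) (ltn_ord v)).
    exact: val_inj.
  rewrite (reindex_inj pos_inj); apply: eq_bigr => u _ /=.
  by rewrite nth_sweep // ranks_below_lt.
have -> : \sum_j (T ord_max j < q) =
    \sum_(0 <= u < size w) nth East w u * (nrank m n w u + k * n + 1 < nrank m n w t.+1).
  rewrite -(sum_north_ranks w_dyck (fun z => z + k * n + 1 < nrank m n w t.+1 : nat)).
  apply: eq_bigr => j _; have [u [lt_u wu sj]] := nth_north_ranks w_dyck j.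
  rewrite (TE u j) // ranks_below_lt ?u1 // sj.
  by rewrite (nrank_north n_gt0 w_dyck).
(* Both ends of the path have rank 0, so the starting ranks and the end ranks of the steps form the
   same multiset. *)
have -> : q = \sum_(0 <= u < size w) (nrank m n w u.+1 < nrank m n w t.+1).
  rewrite /q /ranks_below; case: (size w) (nrank_size w_dyck) lt_t => // N rN _.
  rewrite big_nat_recl // big_nat_recr //= rN nrank0 addnC; congr addn.
rewrite -big_split; apply: eq_big_nat => u /andP[_ lt_u] /=.
case wu: (nth East w u); rewrite /= ?addn0 ?mul1n ?mul0n ?add0n.
  by rewrite (nrank_north n_gt0 w_dyck).
rewrite (nrank_east n_gt0 w_dyck lt_u) ?wu // (nrank_east n_gt0 w_dyck lt_t) //.
by rewrite ltn_add2r.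
Qed.

(** Both paths are followed from the origin. They share the swept word and the tableau, which
    determine the position of the next vertex from the current one: by [north_target] after a North
    step, by [east_target] and [count_below_inj] after an East step. *)
Lemma sweep_inj w1 w2 : dyck m n w1 -> dyck m n w2 ->
  sweep m n w1 = sweep m n w2 -> w1 = w2.
Proof.
move=> dw1 dw2 e; have sz2 := size_dyck dw2; have sz1 := size_dyck dw1.
have sz : size w2 = size w1 by rewrite sz1 sz2.
have eT : standardize (level_array k n w1) = standardize (level_array k n w2).
  by rewrite -!tableau_sweep // e.
have letter w t : dyck m n w -> t < size w ->
    nth East w t = nth East (sweep m n w) (ranks_below k n w (nrank m n w t)).
  by move=> dw lt_t; rewrite nth_sweep.
suff pos t : t < size w1 -> ranks_below k n w1 (nrank m n w1 t) =
    ranks_below k n w2 (nrank m n w2 t).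
  apply: (@eq_from_nth _ East) => // t lt_t.
  by rewrite (letter w1) // (letter w2) ?sz // e pos.
elim: t => [_|t IH lt_t1].
  by rewrite !nrank0 /ranks_below !big1.
have lt_t := ltnW lt_t1; have {}IH := IH lt_t.
have wt : nth East w1 t = nth East w2 t by rewrite (letter w1) // (letter w2) ?sz // e IH.
case w1t: (nth East w1 t).
  have [j sj] := north_ranks_nth dw1 lt_t w1t.
  have Tj : standardize (level_array k n w1) ord0 j =
      (ranks_below k n w1 (nrank m n w1 t)).+1.
    by rewrite standardize_level // mul0n addn0 sj ranks_belowS.
  rewrite (north_target dw1 lt_t w1t Tj) eT; apply/esym/north_target => //.
  - by rewrite sz.
  - by rewrite -wt.
  - by rewrite -eT Tj IH.
have [h1 e1] := east_target dw1 lt_t1 (negbT w1t).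
have lt_t2 : t.+1 < size w2 by rewrite sz.
have w2t : ~~ nth East w2 t by rewrite -wt w1t.
have [h2 e2] := east_target dw2 lt_t2 w2t.
rewrite -e sz -eT -IH in h2 e2; apply: count_below_inj h1 h2 e1 e2.
move=> j j' /(fuss_inj (fuss_standardize_level n_gt0 dw1)).
by case.
Qed.

Lemma sweep_surj D : dyck m n D -> exists2 P, dyck m n P & sweep m n P = D.
Proof.
move=> dD; pose N := k.+1 * n + 1.
have szs (t : N.-tuple bool) : size (sweep m n t) == N.
  by rewrite size_map size_sort size_iota size_tuple.
pose f (t : N.-tuple bool) : N.-tuple bool := Tuple (szs t).
pose A := [set t : N.-tuple bool | dyck m n t].
have fA : f @: A = A.
  apply/eqP; rewrite eqEcard card_in_imset ?leqnn ?andbT.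
    by apply/subsetP => _ /imsetP[t tA ->]; rewrite !inE in tA *; apply: dyck_sweep.
  move=> t u; rewrite !inE => dt du /(congr1 val) /= /(sweep_inj dt du) tu.
  exact: val_inj.
have szD : size D == N by rewrite (size_dyck dD).
have : Tuple szD \in f @: A by rewrite fA inE.
case/imsetP=> t; rewrite inE => dt [eD]; by exists t.
Qed.

(** Surjectivity of the sweep map extends to all Dyck paths an identity known for swept ones. *)
Lemma fuss_wordK D : dyck m n D -> fuss_word (tableau k n D) = D.
Proof. by move=> /sweep_surj[P dP <-]; rewrite tableau_sweep // sweep_fuss_word. Qed.

End SweepInverse.

(** * Cutting a path *)

Lemma count_take_cat (b : bool) (w1 w2 : lpath) s :
  count_mem b (take (size w1 + s) (w1 ++ w2)) = count_mem b w1 + count_mem b (take s w2).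
Proof. by rewrite takeD take_size_cat // drop_size_cat // count_cat. Qed.

Lemma count_take_rot_low (b : bool) (w : lpath) v s : s <= size w - v ->
  count_mem b (take s (rot v w)) + count_mem b (take v w) = count_mem b (take (v + s) w).
Proof.
move=> le_s; rewrite /rot takel_cat ?size_drop // takeD count_cat addnC.
by [].
Qed.

Lemma count_take_rot_high (b : bool) (w : lpath) v s : v <= size w -> s <= v ->
  count_mem b (take (size w - v + s) (rot v w)) + count_mem b (take v w) =
  count_mem b w + count_mem b (take s w).
Proof.
move=> le_v le_s; rewrite /rot -size_drop count_take_cat.
rewrite -take_min (minn_idPl le_s) addnAC; congr addn.
by rewrite addnC -count_cat cat_take_drop.
Qed.

Lemma nth_rot_low (w : lpath) v s : s < size w - v ->
  nth East (rot v w) s = nth East w (v + s).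
Proof. by move=> lt_s; rewrite /rot nth_cat size_drop lt_s nth_drop. Qed.

Lemma nth_rot_high (w : lpath) v s : v <= size w -> s < v ->
  nth East (rot v w) (size w - v + s) = nth East w s.
Proof.
move=> le_v lt_s; rewrite /rot nth_cat size_drop ltnNge leq_addr /=.
by rewrite addKn nth_take.
Qed.

Lemma cut_pathE k (w : lpath) v : cut_path k w v = North :: rot v w ++ nseq k East.
Proof. by rewrite /cut_path /rot /= catA. Qed.

(** Here [(xv, yv)] is the base of a rotation and [c] the number of laps; a full lap adds [(mm, n)],
    of rank 0, so ranks only shift by that of the base. *)
Lemma rank_shift (mm n x y xv yv xs ys c : nat) :
    x + xv = c * mm + xs -> y + yv = c * n + ys ->
    xs * n <= ys * mm -> xv * n <= yv * mm ->
  x * n <= y * mm + (yv * mm - xv * n) /\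
  ys * mm - xs * n + x * n = y * mm + (yv * mm - xv * n).
Proof.
move=> /(congr1 (muln^~ n)) ex /(congr1 (muln^~ mm)) ey; move: ex ey => /=.
rewrite !mulnDl (mulnAC c mm); lia.
Qed.

(* Writing the new rank as [n.+1 * a + b.+1] with [a = k * b.+1 - x], the old
   one is [n * a + b]. *)
Lemma cut_rank_ge0 k n b x : 0 < n -> x * n <= b * (k * n + 1) + k * n -> b <= n ->
  x * n.+1 <= b.+1 * (k * n.+1 + 1).
Proof.
move=> n_gt0 le_x le_b; case: (leqP x (k * b.+1)) => [le_xk|lt_xk]; first by nia.
(* With [a] negative, [n * a + b >= 0] and [b <= n] leave only [a = -1] and [b = n], where the new
   rank is 0. *)
have xE : x = (k * b.+1).+1.
  apply/eqP; rewrite eqn_leq lt_xk andbT -ltnS ltnNge; apply/negP => lt_x.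
  have : (k * b.+1).+2 * n <= x * n by rewrite leq_mul.
  nia.
nia.
Qed.

(** With [a = k * b.+1 - x] one has [u = n * a + b]; the strict bound on [b], available where a
    North step starts, gives [u %/ n = a]. *)
Lemma cut_rankE k n b x : x * n <= b * (k * n + 1) + k * n -> b < n ->
  let u := b * (k * n + 1) + k * n - x * n in
  b.+1 * (k * n.+1 + 1) - x * n.+1 = (u + u %/ n).+1.
Proof.
move=> le_x lt_b u; have le_xk : x <= k * b.+1.
  rewrite leqNgt; apply/negP => lt_x.
  have : (k * b.+1).+1 * n <= x * n by rewrite leq_mul.
  nia.
have uE : u = (k * b.+1 - x) * n + b by rewrite /u mulnBl; nia.
rewrite uE divnMDl ?divn_small ?addn0 //; last by lia.
have : x * n <= k * b.+1 * n by rewrite leq_mul.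
rewrite mulnBl; nia.
Qed.

(** * Ranks along a cut path *)

Section Cut.
Variables (k n : nat) (w : lpath) (v : nat).
Local Notation m := (k * n + 1).
Local Notation m1 := (k * n.+1 + 1).
Hypotheses (n_gt0 : 0 < n) (w_dyck : dyck m n w) (lt_v : v < size w).
Local Notation r := (nrank m n w).
Local Notation Q := (rot v w).
Local Notation P := (cut_path k w v).

Lemma rot_rank_low s : v + s <= size w ->
  xcoord Q s * n <= ycoord Q s * m + r v /\
  r (v + s) + xcoord Q s * n = ycoord Q s * m + r v.
Proof.
move=> le_s; have le_s' : s <= size w - v by lia.
apply: (@rank_shift _ _ _ _ _ _ _ _ 0).
- exact: count_take_rot_low.
- exact: count_take_rot_low.
- exact: dyck_le.
- by apply: dyck_le => //; apply: ltnW.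
Qed.

Lemma rot_rank_high s : s <= v ->
  xcoord Q (size w - v + s) * n <= ycoord Q (size w - v + s) * m + r v /\
  r s + xcoord Q (size w - v + s) * n = ycoord Q (size w - v + s) * m + r v.
Proof.
move=> le_s; case/dyckP: (w_dyck) => cx cy _ _.
apply: (@rank_shift _ _ _ _ _ _ _ _ 1); rewrite ?mul1n.
- by rewrite /xcoord count_take_rot_high ?cx // ltnW.
- by rewrite /ycoord count_take_rot_high ?cy // ltnW.
- by apply: dyck_le => //; apply: leq_trans le_s (ltnW lt_v).
- by apply: dyck_le => //; apply: ltnW.
Qed.

Lemma rot_rank s : s <= size w -> xcoord Q s * n <= ycoord Q s * m + r v.
Proof.
move=> le_s; case: (leqP (v + s) (size w)) => [le_vs|lt_vs].
  by case: (rot_rank_low le_vs).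
have e : s = size w - v + (s - (size w - v)) by lia.
by rewrite e; case: (@rot_rank_high (s - (size w - v))) => //; lia.
Qed.

Lemma count_rot (b : bool) : count_mem b Q = count_mem b w.
Proof. by apply/seq.permP; rewrite perm_rot. Qed.

Lemma ycoord_rot_le s : ycoord Q s <= n.
Proof.
case/dyckP: w_dyck => _ <- _ _; rewrite /ycoord -count_rot.
by rewrite -[X in _ <= count _ X](cat_take_drop s Q) count_cat leq_addr.
Qed.

Lemma ycoord_rot_lt s : s < size w -> nth East Q s -> ycoord Q s < n.
Proof.
move=> lt_s Qs; apply: leq_trans (ycoord_rot_le s.+1).
by rewrite ycoordS ?size_rot // Qs addn1.
Qed.

Lemma cut_coord s : s <= size w ->
  xcoord P s.+1 = xcoord Q s /\ ycoord P s.+1 = (ycoord Q s).+1.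
Proof.
move=> le_s; rewrite cut_pathE /xcoord /ycoord /=.
by rewrite takel_cat ?size_rot.
Qed.

Lemma size_cut : size P = size w + k.+1.
Proof. by rewrite cut_pathE /= size_cat size_rot size_nseq addnS. Qed.

Hypothesis le_rv : r v <= k * n.

(** Relative to its start the rotated path has ranks at least [- r v], hence at least [- (k * n)],
    and [cut_rank_ge0] applies. The final East steps run at full height, where only the abscissa
    must be bounded. *)
Lemma dyck_cut : dyck m1 n.+1 P.
Proof.
case/dyckP: (w_dyck) => cx cy szw _.
have cxP : count_mem East P = m1.
  by rewrite cut_pathE /= count_cat count_rot cx count_nseq /= mul1n mulnS; lia.
have cyP : count_mem North P = n.+1.
  by rewrite cut_pathE /= count_cat count_rot cy count_nseq /= mul0n; lia.
apply/dyckP; split=> //; first by rewrite size_cut szw mulnS; lia.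
case=> [_|s]; first by rewrite /xcoord take0.
rewrite size_cut => le_s; case: (leqP s (size w)) => [le_sw|lt_sw].
  have [-> ->] := cut_coord le_sw; apply: cut_rank_ge0 => //; last exact: ycoord_rot_le.
  by apply: leq_trans (rot_rank le_sw) _; rewrite leq_add2l.
have -> : ycoord P s.+1 = n.+1.
  apply/eqP; rewrite eqn_leq; apply/andP; split.
    rewrite -cyP /ycoord -[X in _ <= count _ X](cat_take_drop s.+1 P).
    by rewrite count_cat leq_addr.
  have [_ le_y] := coord_mono P (leqW lt_sw); apply: leq_trans le_y.
  have [_ ->] := cut_coord (leqnn (size w)).
  by rewrite /ycoord take_oversize ?size_rot // count_rot cy.
rewrite mulnC leq_mul2l /= -cxP /xcoord -[X in _ <= count _ X](cat_take_drop s.+1 P).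
by rewrite count_cat leq_addr.
Qed.

(** For [u = n * a + b] with [b < n] the value is [n.+1 * a + b.+1], so a shift by [n] becomes a
    shift by [n.+1]. The bound [le_rv] keeps the subtraction exact. *)
Definition cut_rank z := let u := z + k * n - r v in (u + u %/ n).+1.

Lemma cut_rank_mono z z' : (cut_rank z <= cut_rank z') = (z <= z').
Proof.
have homo a b : a < b -> cut_rank a < cut_rank b.
  move=> lt_ab; rewrite /cut_rank /= ltnS -addSn; apply: leq_add; first by lia.
  by apply: leq_div2r; lia.
case: (ltngtP z z') => [/homo/ltnW //|/homo lt|->]; last exact: leqnn.
by apply/negbTE; rewrite -ltnNge.
Qed.

Lemma cut_rankD z i : cut_rank (z + i * n) = cut_rank z + i * n.+1.
Proof.
rewrite /cut_rank /=; have -> : z + i * n + k * n - r v = i * n + (z + k * n - r v) by lia.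
by rewrite divnMDl // mulnS; lia.
Qed.

Lemma nrank_cut s : s < size w -> nth East Q s ->
  nrank m1 n.+1 P s.+1 =
  (let u := ycoord Q s * m + k * n - xcoord Q s * n in (u + u %/ n).+1).
Proof.
move=> lt_s Qs; rewrite /nrank; have [-> ->] := cut_coord (ltnW lt_s).
apply: cut_rankE; last exact: ycoord_rot_lt.
by apply: leq_trans (rot_rank (ltnW lt_s)) _; rewrite leq_add2l.
Qed.

Lemma nrank_cut_low s : v + s < size w -> nth East w (v + s) ->
  nrank m1 n.+1 P s.+1 = cut_rank (r (v + s)).
Proof.
move=> lt_s ws; rewrite nrank_cut; [|lia|by rewrite nth_rot_low //; lia].
have [le_s e] := rot_rank_low (ltnW lt_s); rewrite /cut_rank /=.
by have -> : ycoord Q s * m + k * n - xcoord Q s * n = r (v + s) + k * n - r v by lia.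
Qed.

Lemma nrank_cut_high s : s < v -> nth East w s ->
  nrank m1 n.+1 P (size w - v + s).+1 = cut_rank (r s).
Proof.
move=> lt_s ws; rewrite nrank_cut; [|lia|by rewrite nth_rot_high // ltnW].
have [le_s e] := rot_rank_high (ltnW lt_s); rewrite /cut_rank /=.
by set x := xcoord _ _ in le_s e *; set y := ycoord _ _ in le_s e *;
  have -> : y * m + k * n - x * n = r s + k * n - r v by lia.
Qed.

(** The initial North step contributes 0 and the final East steps nothing. Exchanging the two blocks
    of [w] only permutes its North steps, which sorting forgets. *)
Lemma north_ranks_cut :
  north_ranks k n.+1 P = 0 :: map cut_rank (north_ranks k n w).
Proof.
apply: (sorted_eq leq_trans anti_leq).
- exact: sort_sorted leq_total _.
- rewrite /= path_min_sorted; last by apply/allP.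
  apply: homo_sorted (sort_sorted leq_total _) => a b.
  by rewrite cut_rank_mono.
rewrite perm_sort perm_sym.
apply: (@perm_trans _ (0 :: [seq cut_rank (r t) | t <- iota 0 (size w) & nth East w t])).
  rewrite perm_cons (map_comp cut_rank r); apply: perm_map.
  exact: permEl (perm_sort _ _).
have szE : size P = 1 + ((size w - v) + (v + k)) by rewrite size_cut; lia.
rewrite szE !iotaD /= perm_cons !filter_cat !map_cat.
have -> : [seq t <- iota (1 + (size w - v) + v) k | nth East P t] = [::].
  apply/eqP; rewrite -size_eq0 size_filter -leqn0 leqNgt -has_count; apply/hasPn.
  move=> t; rewrite mem_iota => lt_t; rewrite cut_pathE.
  have -> : t = (t.-1).+1 by lia.
  rewrite /= nth_cat size_rot ifF; last by apply/negbTE; lia.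
  by rewrite nth_nseq if_same.
rewrite cats0.
have -> : iota 0 (size w) = iota 0 v ++ iota v (size w - v).
  by rewrite -{1}(subnKC (ltnW lt_v)) iotaD.
rewrite filter_cat map_cat perm_catC.
have iotaE a N : iota a N = [seq a + i | i <- iota 0 N] by rewrite -iotaDl addn0.
have eqB : [seq nrank m1 n.+1 P i | i <- iota 1 (size w - v) & nth East P i] =
    [seq cut_rank (r t) | t <- iota v (size w - v) & nth East w t].
  rewrite (iotaE 1) (iotaE v).
  rewrite !filter_map -!map_comp.
  have eqf : {in iota 0 (size w - v), forall s,
      nth East P (1 + s) = nth East w (v + s)}.
    move=> s; rewrite mem_iota => lt_s; rewrite cut_pathE /= nth_cat size_rot ifT; last lia.
    by rewrite nth_rot_low.
  rewrite (eq_in_filter eqf); apply/eq_in_map => s.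
  rewrite mem_filter mem_iota => /andP[/= ws lt_s].
  by rewrite nrank_cut_low //; lia.
have eqA : [seq nrank m1 n.+1 P i | i <- iota (1 + (size w - v)) v & nth East P i] =
    [seq cut_rank (r t) | t <- iota 0 v & nth East w t].
  rewrite iotaE.
  rewrite !filter_map -!map_comp.
  have eqf : {in iota 0 v, forall s,
      nth East P (1 + (size w - v) + s) = nth East w s}.
    move=> s; rewrite mem_iota => lt_s; rewrite cut_pathE /= nth_cat size_rot ifT; last lia.
    by rewrite nth_rot_high // ltnW.
  rewrite (eq_in_filter eqf); apply/eq_in_map => s.
  rewrite mem_filter mem_iota => /andP[/= ws lt_s].
  by rewrite addSn nrank_cut_high.
by rewrite eqA eqB.
Qed.

(** Deleting the first column removes the new rank 0; the remaining array is the image of the old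
    one under the strictly increasing [cut_rank]. *)
Lemma red_sweep_cut :
  red (tableau k n.+1 (sweep m1 n.+1 P)) = tableau k n (sweep m n w).
Proof.
rewrite !tableau_sweep ?dyck_cut //; apply: eq_standardize => i j i' j'.
have colE (A : 'M[nat]_(k.+1, n.+1)) a b : col' ord0 A a b = A a (lift ord0 b).
  by rewrite mxE.
rewrite !colE standardize_le !mxE north_ranks_cut.
by rewrite !lift0 /= !(nth_map 0) ?(size_north_ranks w_dyck) // -!cut_rankD cut_rank_mono.
Qed.

End Cut.

(** Relative to its start, a rotation of [w] has as least rank the opposite of the rank of its base,
    attained at the origin of [w]. Equal rotations thus have bases of equal rank. *)
Lemma cut_path_inj k n (w : lpath) v1 v2 : 0 < n -> dyck (k * n + 1) n w ->
  v1 < size w -> v2 < size w -> cut_path k w v1 = cut_path k w v2 -> v1 = v2.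
Proof.
move=> n_gt0 w_dyck lt1 lt2; rewrite !cut_pathE => -[] /(congr1 (take (size w))).
rewrite !take_cat !size_rot ltnn subnn take0 !cats0 => eq_rot.
have le_rank a b : a < size w -> b < size w -> rot a w = rot b w ->
    nrank (k * n + 1) n w a <= nrank (k * n + 1) n w b.
  move=> lt_a lt_b eab; have le_s : size w - a + 0 <= size w by lia.
  have := rot_rank n_gt0 w_dyck lt_b le_s; rewrite -eab.
  by have [_] := rot_rank_high w_dyck lt_a (leq0n a); rewrite nrank0; lia.
apply: (nrank_inj n_gt0 w_dyck) => //; apply/eqP; rewrite eqn_leq.
by rewrite !le_rank.
Qed.

(** A North step starts at height [y <= n], where nonnegative rank means [x <= k * y]; so its index
    is at most [k.+1 * n]. *)
Lemma dyck_east_tail k n (w : lpath) t : dyck (k * n.+1 + 1) n.+1 w ->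
  size w - k.+1 <= t < size w -> nth East w t = East.
Proof.
move=> w_dyck /andP[le_t lt_t]; apply/negbTE/negP => wt.
have := dyck_le w_dyck (ltnW lt_t); have := coord_sum (ltnW lt_t).
have [_] := coord_bound w_dyck t.+1; rewrite ycoordS // wt.
rewrite (size_dyck w_dyck) in le_t.
set x := xcoord w t; set y := ycoord w t => le_y xy le_x.
have {}le_x : x <= k * y.
  rewrite -ltnS ltnNge; apply/negP => lt_x.
  have : (k * y).+1 * n.+1 <= x * n.+1 by rewrite leq_mul.
  nia.
nia.
Qed.

(** Converse of [cut_rank_ge0]: again [a = k * b.+1 - x] can be negative only for [a = -1] and
    [b = n], where both ranks are 0. *)
Lemma rank_ge0_uncut k n b x : x * n.+1 <= b.+1 * (k * n.+1 + 1) -> b <= n ->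
  x * n <= b * (k * n + 1) + k * n.
Proof.
move=> le_x le_b; case: (leqP x (k * b.+1)) => [le_xk|lt_xk]; first by nia.
have : (k * b.+1).+1 * n.+1 <= x * n.+1 by rewrite leq_mul.
move=> le_kb; have bn : b = n by nia.
rewrite bn in le_x lt_xk le_kb *; have -> : x = (k * n.+1).+1; last by nia.
apply/eqP; rewrite eqn_leq lt_xk andbT -ltnS ltnNge; apply/negP => lt_x.
have : (k * n.+1).+2 * n.+1 <= x * n.+1 by rewrite leq_mul.
nia.
Qed.

Lemma rank_rotate (m n x y xu yu xs ys c : nat) :
    x + xu = c * m + xs -> y + yu = c * n + ys ->
  (x * n <= y * m) = (yu * m + xs * n <= ys * m + xu * n).
Proof.
move=> /(congr1 (muln^~ n)) ex /(congr1 (muln^~ m)) ey; move: ex ey => /=.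
rewrite !mulnDl (mulnAC c m); lia.
Qed.

Lemma rank_complement (m n x y xu yu c : nat) :
    x + xu = m -> y + yu = n -> xu * n <= yu * m + c -> y * m - x * n <= c.
Proof. by move=> /(congr1 (muln^~ n)) + /(congr1 (muln^~ m)); rewrite /= !mulnDl; lia. Qed.

(** A form of the cycle lemma: the middle part of [P] may have negative ranks, and rotating it at a
    vertex of least rank makes it a Dyck path. *)
Lemma cut_path_surj k n (P : lpath) : 0 < n -> dyck (k * n.+1 + 1) n.+1 P ->
  exists w v, [/\ dyck (k * n + 1) n w, v < size w,
    nrank (k * n + 1) n w v <= k * n & P = cut_path k w v].
Proof.
move=> n_gt0 P_dyck; have szP := size_dyck P_dyck; pose N := k.+1 * n + 1.
have szPN : size P = (N + k).+1 by rewrite szP /N; lia.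
pose Q := take N (behead P).
have szQ : size Q = N by rewrite size_takel // size_behead szPN leq_addr.
have PE : P = North :: Q ++ nseq k East.
  have -> : nseq k East = drop N (behead P).
    apply: (@eq_from_nth _ East); first by rewrite size_nseq size_drop size_behead szPN addKn.
    move=> t; rewrite size_nseq => lt_t; rewrite nth_nseq lt_t nth_drop nth_behead.
    by rewrite (dyck_east_tail P_dyck) // szPN; lia.
  rewrite cat_take_drop; have := nth_head_dyck (ltn0Sn n) P_dyck.
  by case: (P) szPN => //= b s _ ->.
case/dyckP: (P_dyck) => cxP cyP _ leP.
have cx : count_mem East Q = k * n + 1.
  by move: cxP; rewrite PE /= count_cat count_nseq /= mul1n mulnS; lia.
have cy : count_mem North Q = n.
  by move: cyP; rewrite PE /= count_cat count_nseq /= mul0n; lia.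
have [m mE] : {m | m = k * n + 1} by exists (k * n + 1).
rewrite -mE in cx *.
have x_le s : xcoord Q s <= m.
  rewrite -cx /xcoord -[X in _ <= count _ X](cat_take_drop s Q).
  by rewrite count_cat leq_addr.
have N_gt0 : 0 < N by rewrite /N addn1.
(* The rank in [Q], shifted by [m * n] to be natural. *)
pose key (i : 'I_N) := ycoord Q i.+1 * m + (m - xcoord Q i.+1) * n.
have [i _ min_i] := arg_minnP key (isT : predT (Ordinal N_gt0)).
(* Minimizing over the vertices [1] to [N] makes the cut [N - u] smaller than [N]. *)
set u := i.+1; have lt_u : i < N := ltn_ord i.
have min_u s : s <= N -> ycoord Q u * m + xcoord Q s * n <= ycoord Q s * m + xcoord Q u * n.
  have pos s' : 0 < s' <= N ->
      ycoord Q u * m + xcoord Q s' * n <= ycoord Q s' * m + xcoord Q u * n.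
    case: s' => // s' /= lt_s; have := min_i (Ordinal lt_s) isT.
    have := leq_mul (x_le s'.+1) (leqnn n); have := leq_mul (x_le u) (leqnn n).
    by rewrite /key /= !mulnBl -/u; lia.
  case: s => [_|s lt_s]; last exact: pos.
  (* Vertices [0] and [N] of [Q] have the same rank. *)
  have := pos N; rewrite N_gt0 leqnn => /(_ isT).
  by rewrite /xcoord /ycoord take0 [take N Q]take_oversize ?szQ // cx cy /= (mulnC n m); lia.
pose w := rot u Q; have szw : size w = N by rewrite size_rot.
have low b s : s <= N - u ->
    count_mem b (take s w) + count_mem b (take u Q) = count_mem b (take (u + s) Q).
  by rewrite -szQ; apply: count_take_rot_low.
have high b s : s <= u ->
    count_mem b (take (N - u + s) w) + count_mem b (take u Q) =
    count_mem b Q + count_mem b (take s Q).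
  by rewrite -szQ; apply: count_take_rot_high; rewrite szQ.
have w_dyck : dyck m n w.
  apply/dyckP; split; rewrite ?szw.
  - by rewrite -cx; apply/seq.permP; rewrite perm_rot.
  - by rewrite -[RHS]cy; apply/seq.permP; rewrite perm_rot.
  - by rewrite /N mE mulSn; lia.
  move=> s le_s; case: (leqP s (N - u)) => [le_su|lt_su].
    have le_us : u + s <= N by lia.
    rewrite (rank_rotate (c := 0) (low East _ le_su) (low North _ le_su)).
    exact: min_u.
  have [s' sE le_s'] : exists2 s', s = N - u + s' & s' <= u.
    by exists (s - (N - u)); lia.
  have ex := high East _ le_s'; have ey := high North _ le_s'.
  rewrite cx -(mul1n m) -sE in ex; rewrite cy -(mul1n n) -sE in ey.
  by rewrite (rank_rotate ex ey) min_u // (leq_trans le_s').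
exists w, (N - u); split=> //.
- by rewrite szw; lia.
(* The rank of the cut vertex in [w] is the opposite of the rank of vertex [u] in [Q]; the latter is
   vertex [u.+1] of [P], whose nonnegative rank gives the bound. *)
- have := leP u.+1; rewrite szPN PE /xcoord /ycoord /= takel_cat ?szQ //.
  have := high East 0 isT; have := high North 0 isT.
  rewrite !addn0 !take0 /= !addn0 cx cy add0n add1n => ey ex le_u.
  apply: (rank_complement ex ey); rewrite mE; apply: rank_ge0_uncut; last by lia.
  by apply: le_u; rewrite !ltnS; apply: leq_trans (leq_addr _ _).
- rewrite cut_pathE PE; congr (_ :: _ ++ _); apply/esym.
  by rewrite -szw -/(rotr u w) rotK.
Qed.

(** * The fibres of the reduction *)

Theorem theorem4p1 (k n' : nat) (hk : 1 <= k) (hn' : 1 <= n')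
    (T' : 'M[nat]_(k.+1, n')) (hT' : fuss_tableau T') :
  let n := n'.+1 in
  let m := k * n + 1 in
  let m' := k * n' + 1 in
  #|[set D : (m + n).-tuple bool | dyck m n D && (red (tableau k n D) == T')]|
    = T' ord_max (Ordinal hn')
  /\
  exists D' P' : lpath,
    [/\ unique (fun D => dyck m' n' D /\ tableau k n' D = T') D',
        unique (fun P => dyck m' n' P /\ sweep m' n' P = D') P',
        forall v : nat, v < m' + n' -> (vrank m' n' P' v < m'%:Z)%R ->
          dyck m n (cut_path k P' v) &
        forall D : lpath,
          (dyck m n D /\ red (tableau k n D) = T') <->
          exists v : nat,
            [/\ v < m' + n', (vrank m' n' P' v < m'%:Z)%R &
                D = sweep m n (cut_path k P' v)]].
Proof.
move=> n m m'; pose D' := fuss_word T'.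
have D'_dyck : dyck m' n' D' by apply: dyck_fuss_word.
have tabD' : tableau k n' D' = T' by apply: tableau_fuss_word.
have [P' P'_dyck sweepP'] := sweep_surj hn' D'_dyck.
have szP' : size P' = m' + n' by case/dyckP: P'_dyck.
have D'_unique D : dyck m' n' D -> tableau k n' D = T' -> D' = D.
  by move=> D_dyck tabD; rewrite /D' -tabD fuss_wordK.
have rankE v : v < m' + n' ->
    (vrank m' n' P' v < m'%:Z)%R = (nrank m' n' P' v <= k * n').
  move=> lt_v; have le_v : v <= size P' by rewrite szP' ltnW.
  by rewrite (vrank_nrank P'_dyck le_v) -ltnS -(addn1 (k * n')).
have cut_dyck v : v < m' + n' -> (vrank m' n' P' v < m'%:Z)%R ->
    dyck m n (cut_path k P' v).
  by move=> lt_v; rewrite rankE // => le_v; apply: dyck_cut => //; rewrite szP'.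
have fiberP D : (dyck m n D /\ red (tableau k n D) = T') <->
    exists v : nat, [/\ v < m' + n', (vrank m' n' P' v < m'%:Z)%R &
      D = sweep m n (cut_path k P' v)].
  split=> [[D_dyck redD]|[v [lt_v rk_v ->]]].
    have [P P_dyck DE] := sweep_surj (ltn0Sn n') D_dyck.
    have [w [v [w_dyck lt_v le_v PE]]] := cut_path_surj hn' P_dyck.
    (* The sweeps of [w] and [P'] both have tableau [T'], which determines a Dyck path. *)
    have wP' : w = P'.
      apply: (sweep_inj hn' w_dyck P'_dyck); rewrite sweepP'; apply/esym/D'_unique.
        exact: dyck_sweep.
      by rewrite -(red_sweep_cut hn' w_dyck lt_v le_v) -PE DE.
    rewrite wP' szP' in lt_v le_v PE; exists v; rewrite rankE //.
    by rewrite -PE DE.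
  have P_dyck := cut_dyck v lt_v rk_v; split; first exact: dyck_sweep.
  by rewrite rankE // in rk_v; rewrite red_sweep_cut ?szP' // sweepP'.
split; last first.
  exists D', P'; split=> //; first by split=> // D [dD]; apply: D'_unique.
  split=> // P [P_dyck sweepP]; apply: (sweep_inj hn' P'_dyck P_dyck).
  by rewrite sweepP' sweepP.
have szf (v : 'I_(m' + n')) : size (sweep m n (cut_path k P' v)) == m + n.
  rewrite size_map size_sort size_iota size_cut szP' /m /m' /n mulnS; apply/eqP; lia.
pose f v : (m + n).-tuple bool := Tuple (szf v).
pose V := [set v : 'I_(m' + n') | (vrank m' n' P' v < m'%:Z)%R].
have -> : [set D : (m + n).-tuple bool | dyck m n D && (red (tableau k n D) == T')]
    = f @: V.
  apply/setP => D; rewrite inE; apply/andP/imsetP => [[D_dyck /eqP redD]|].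
    have /fiberP[v [lt_v rk_v DE]] : dyck m n D /\ red (tableau k n D) = T' by [].
    by exists (Ordinal lt_v); rewrite ?inE //; apply: val_inj.
  case=> v; rewrite inE => rk_v ->.
  have [|D_dyck redD] := (fiberP (f v)).2; last by rewrite redD eqxx.
  by exists v.
rewrite card_in_imset; last first.
  move=> v1 v2; rewrite !inE => rk1 rk2 /(congr1 val) /= e; apply: val_inj.
  apply: (cut_path_inj hn' P'_dyck); rewrite ?szP' ?ltn_ord //.
  have dyck1 := cut_dyck _ (ltn_ord v1) rk1.
  have dyck2 := cut_dyck _ (ltn_ord v2) rk2.
  exact: (sweep_inj (ltn0Sn n') dyck1 dyck2 e).
(* The first North rank is 0, so the bottom entry of the first column counts the starting ranks at
   most [k * n'], that is the elements of [V]. *)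
rewrite -tabD' -sweepP' tableau_sweep // standardize_level //.
rewrite north_ranks_head // add0n /ranks_below szP' big_mkord.
rewrite -sum1_card big_mkcond; apply: eq_bigr => v _.
by rewrite inE rankE // ltnS; case: leqP.
Qed.
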